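(* Let $C_n$ be the cycle on $n\ge3$ vertices. Then $C_n$ is $1$-elementary if and only if $n=3k$ for some positive integer $k$.
   Context: All graphs are finite and simple. $\mu(G,x)=\sum_{r\ge0}(-1)^r p(G,r)x^{n-2r}$ is the matching polynomial of a graph $G$ on $n$ vertices, where $p(G,r)$ is the number of $r$-matchings ($p(G,0)=1$); $\mathrm{mult}(\theta,G)$ is the multiplicity of $\theta$ as a root of $\mu(G,x)$. $G\setminus v$ denotes deletion of vertex $v$. A vertex $u$ of $H$ is $\theta$-essential if $\mathrm{mult}(\theta,H\setminus u)=\mathrm{mult}(\theta,H)-1$, $\theta$-positive if $\mathrm{mult}(\theta,H\setminus u)=\mathrm{mult}(\theta,H)+1$, and $\theta$-special if it is not $\theta$-essential but is adjacent to a $\theta$-essential vertex. $P_\theta(H)$ is the set of $\theta$-positive vertices of $H$ that are not $\theta$-special. $G$ is $\theta$-super positive if $\mathrm{mult}(\theta,G)=0$ and every vertex is $\theta$-positive; $G$ is $\theta$-elementary if it is $\theta$-super positive and $P_\theta(G\setminus v)=\varnothing$ for all $v\in V(G)$. *)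

(* Defs.v *)
From HB Require Import structures.
From mathcomp Require Import all_boot all_order all_algebra.

Set Implicit Arguments.
Unset Strict Implicit.
Unset Printing Implicit Defensive.

Import Order.TTheory GRing.Theory Num.Theory.
Local Open Scope ring_scope.

Record graph := Graph {
  vertex :> finType;
  adj : rel vertex;
  adj_sym : symmetric adj;
  adj_irr : irreflexive adj
}.

Section Deletion.
Variables (G : graph) (v : G).

Definition del_adj : rel {u : G | u != v} := fun x y => adj (val x) (val y).

Lemma del_adj_sym : symmetric del_adj.
Proof. by move=> x y; apply: adj_sym. Qed.

Lemma del_adj_irr : irreflexive del_adj.
Proof. by move=> x; apply: adj_irr. Qed.

Definition del : graph := Graph del_adj_sym del_adj_irr.

End Deletion.

Section Matching.
Variable G : graph.

Definition edges : {set {set G}} :=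
  [set e | [exists x, exists y, adj x y && (e == [set x; y])]].

Definition is_matching (M : {set {set G}}) : bool :=
  (M \subset edges) && trivIset M.

Definition num_matchings (r : nat) : nat :=
  #|[set M : {set {set G}} | is_matching M & #|M| == r]|.

(* There is no [r]-matching when [2 * r > #|G|], so the sum stops at
   [r = #|G|./2] and the exponent is never a truncated difference. *)
Definition matching_poly (R : realFieldType) : {poly R} :=
  \sum_(r < (#|G|./2).+1)
     ((-1) ^+ r * (num_matchings r)%:R) *: 'X^(#|G| - 2 * r).

End Matching.

Section Theta.
Variables (R : realFieldType) (theta : R).

Definition mult (G : graph) : nat := mup theta (matching_poly G R).

(* Stated with a successor: in [nat], [mult G - 1] would be [0] when
   [mult G = 0]. *)
Definition essential (G : graph) (u : G) : bool :=
  (mult (del u)).+1 == mult G.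

Definition positive (G : graph) (u : G) : bool :=
  mult (del u) == (mult G).+1.

Definition special (G : graph) (u : G) : bool :=
  ~~ essential u && [exists w : G, adj u w && essential w].

Definition Pset (G : graph) : {set G} :=
  [set u : G | positive u & ~~ special u].

Definition super_positive (G : graph) : bool :=
  (mult G == 0%N) && [forall u : G, positive u].

Definition elementary (G : graph) : bool :=
  super_positive G && [forall v : G, Pset (del v) == set0].

End Theta.

Section Cycle.
Variable n : nat.

(* [ordS i] is [i + 1] modulo [n]; the test [i != j] only matters for
   [n = 1], where it excludes a loop. *)
Definition cycle_adj : rel 'I_n :=
  fun i j => (i != j) && ((j == ordS i) || (i == ordS j)).

Lemma cycle_adj_sym : symmetric cycle_adj.
Proof. by move=> i j; rewrite /cycle_adj eq_sym orbC. Qed.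

Lemma cycle_adj_irr : irreflexive cycle_adj.
Proof. by move=> i; rewrite /cycle_adj eqxx. Qed.

Definition cycle_graph : graph := Graph cycle_adj_sym cycle_adj_irr.

End Cycle.

(* Main.v *)
Require Import Defs.
From mathcomp Require Import all_boot all_order all_algebra.
From mathcomp Require Import zify ring.

Set Implicit Arguments.
Unset Strict Implicit.
Unset Printing Implicit Defensive.

Import Order.TTheory GRing.Theory Num.Theory.
Local Open Scope ring_scope.

(** At [x = 1] the matching polynomial [P_m] of the path on [m] vertices
    satisfies [P_(m+2) = P_(m+1) - P_m], so its values have period 6 and it
    vanishes exactly when [m = 2 mod 3]; there the root is simple because the
    derivative is [+-2(k+1)] for [m = 3k+2].  The cycle polynomial
    [x P_(n-1) - 2 P_(n-2)] never vanishes at 1, and [C_n \ v] is the path on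
    [n-1] vertices, hence all vertices are positive iff [3 %| n].  In that case
    deleting the [r]-th vertex of the path [C_n \ v] gives multiplicity 2 if
    [3 %| r] and 0 otherwise, so the positive vertices are those with [3 %| r],
    and each of them is special because the vertex [r - 1] is essential. *)

(** * Matching polynomials of induced subgraphs and the vertex recurrence *)

Section InducedMatchingPoly.
Variables (R : realFieldType) (G : graph).
Implicit Types (A e : {set G}) (M : {set {set G}}) (v w : G).

Lemma edgesP e :
  reflect (exists v w, adj v w /\ e = [set v; w]) (e \in edges G).
Proof.
rewrite inE; apply: (iffP existsP) => [[v /existsP[w /andP[vw /eqP ->]]]|].
  by exists v, w.
by move=> [v [w [vw ->]]]; exists v; apply/existsP; exists w; rewrite vw /=.
Qed.

Lemma adj_neq v w : adj v w -> v != w.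
Proof. by move=> vw; apply: contraTneq vw => ->; rewrite adj_irr. Qed.

Lemma card_edge e : e \in edges G -> #|e| = 2%N.
Proof. by move=> /edgesP[v [w [/adj_neq vw ->]]]; rewrite cards2 vw. Qed.

Lemma edge_set2 v w : ([set v; w] \in edges G) = adj v w.
Proof.
apply/edgesP/idP => [[x [y [xy E]]]|vw]; last by exists v, w.
have nxy := adj_neq xy.
have : x \in [set v; w] by rewrite E set21.
have : y \in [set v; w] by rewrite E set22.
have : v \in [set x; y] by rewrite -E set21.
have : w \in [set x; y] by rewrite -E set22.
rewrite !inE; case/pred2P=> ->; case/pred2P=> ->; rewrite ?eqxx ?orbT ?orbb //=.
- by rewrite eq_sym (negPf nxy).
- by rewrite adj_sym.
- by rewrite (negPf nxy).
Qed.

Lemma edge_at e v :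
  e \in edges G -> v \in e -> exists2 w, adj v w & e = [set v; w].
Proof.
move=> /edgesP[x [y [xy ->]]]; rewrite !inE => /pred2P[]->; first by exists y.
by exists x; rewrite 1?adj_sym 1?setUC.
Qed.

Lemma card_cover_matching M : is_matching M -> #|cover M| = (2 * #|M|)%N.
Proof.
case/andP=> /subsetP sM /eqP <-.
rewrite (eq_bigr (fun=> 2%N)) => [|e /sM /card_edge //].
by rewrite sum_nat_const mulnC.
Qed.

(* The matching polynomial of the subgraph of [G] induced by [A]; working with
   subsets of one fixed graph avoids iterated subtypes under vertex deletion. *)
Definition induced_poly A : {poly R} :=
  \sum_(M : {set {set G}} | is_matching M && (cover M \subset A))
     (-1) ^+ #|M| *: 'X^(#|A :\: cover M|).

(** Matchings are grouped by size; an [r]-matching covers exactly [2 * r] vertices, which fixes the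
    exponent and bounds [r]. *)
Lemma matching_polyE : matching_poly G R = induced_poly [set: G].
Proof.
pose c M : 'I_(#|G|./2).+1 := inord #|M|.
have cE M : is_matching M -> c M = #|M| :> nat.
  move=> mM; rewrite inordK // ltnS.
  by rewrite -[#|M|]doubleK half_leq // -mul2n -(card_cover_matching mM) max_card.
rewrite /induced_poly (partition_big c xpredT) //=; apply: eq_bigr => r _.
rewrite /num_matchings -sum1_card natr_sum mulr_sumr scaler_suml.
apply: eq_big => M.
  rewrite inE subsetT andbT; case mM: (is_matching M) => //=.
  by rewrite -val_eqE /= cE.
rewrite inE => /andP[mM /eqP <-].
by rewrite mulr1 setTD (cardsCs (~: _)) setCK card_cover_matching.
Qed.

Lemma induced_poly0 : induced_poly set0 = 1.
Proof.
rewrite /induced_poly (big_pred1 set0) => [|M].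
  by rewrite cards0 expr0 set0D cards0 scale1r.
rewrite subset0 /=; apply/andP/eqP => [[mM c0]|->].
  apply/eqP; have := card_cover_matching mM.
  by rewrite (eqP c0) cards0 => /esym/eqP; rewrite muln_eq0 cards_eq0.
split; last by rewrite /cover big_set0.
by rewrite /is_matching sub0set /=; apply/trivIsetP => ?; rewrite inE.
Qed.

(** Lets the vertex recurrence trade matchings through the edge [vw] for matchings avoiding both of
    its ends. *)
Lemma matching_setU1 v w M : adj v w ->
  is_matching ([set v; w] |: M) && ([set v; w] \notin M)
  = is_matching M && [disjoint [set v; w] & cover M].
Proof.
move=> vw; set e := [set v; w].
have e_edge : e \in edges G by rewrite edge_set2.
(* [trivIset] tolerates the empty set as a member; only once it is excluded does disjointness from
   [e] give [e \notin M]. *)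
have edge_n0 f : f \in edges G -> f != set0.
  by move=> /card_edge f2; rewrite -cards_eq0 f2.
apply/andP/andP => [[/andP[sM tM] eM]|[/andP[sM tM] dM]].
  split.
    apply/andP; split; last by apply: trivIsetS tM; apply: subsetUr.
    by apply: subset_trans sM; apply: subsetUr.
  rewrite disjoint_sym disjoints_subset; apply/bigcupsP => f fM.
  rewrite -disjoints_subset; apply: (trivIsetP tM); rewrite ?setU11 ?setU1r //.
  by apply: contraNneq eM => <-.
have [] := @trivIsetU1 _ e M _ tM _.
- move=> f fM; rewrite disjoint_sym; apply: disjointWl (bigcup_sup f fM) _.
  by rewrite disjoint_sym.
- by apply/negP => /(subsetP sM) /edge_n0; rewrite eqxx.
by move=> tM' eM; rewrite /is_matching subUset sub1set e_edge sM tM'.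
Qed.

Lemma cover_setU1 e M : cover (e |: M) = e :|: cover M.
Proof. by rewrite /cover bigcup_setU big_set1. Qed.

(** Matchings are split by whether they cover [v] and, if so, by its partner [w]; removing the edge
    [vw] flips the sign and keeps the set of uncovered vertices. *)
Lemma induced_poly_rec A v : v \in A ->
  induced_poly A = 'X * induced_poly (A :\ v)
     - \sum_(w in A | adj v w) induced_poly (A :\ v :\ w).
Proof.
move=> vA; rewrite /induced_poly.
rewrite (bigID (fun M : {set {set G}} => v \notin cover M)) /=; congr (_ + _).
  rewrite mulr_sumr; apply: eq_big => M; first by rewrite subsetD1 andbA.
  case/andP=> _ vM; rewrite -scalerAr -exprS; congr (_ *: 'X^_).
  by rewrite (cardsD1 v) inE vM vA setDDl setUC -setDDl.
(* The partner of [v] in [M]; the default [v] is never returned for a matching that covers [v]. *)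
pose p M := odflt v [pick w | [set v; w] \in M].
have pP M : is_matching M -> v \in cover M ->
    adj v (p M) && ([set v; p M] \in M).
  case/andP=> /subsetP sM tM /bigcupP[e eM ve].
  have [w _ eE] := edge_at (sM _ eM) ve; rewrite /p; case: pickP => /=.
    by move=> u uM; rewrite -edge_set2 uM sM.
  by move/(_ w); rewrite -eE eM.
have pE M w : is_matching M -> v \in cover M ->
    (p M == w) = ([set v; w] \in M).
  move=> mM vM; have /andP[vp pM] := pP M mM vM.
  apply/eqP/idP => [<- //|wM]; case/andP: mM => /subsetP sM /trivIsetP tM.
  have: [set v; p M] == [set v; w].
    apply: contraT => /(tM _ _ pM wM) /pred0P/(_ v) /=.
    by rewrite !inE !eqxx.
  move/eqP/setP/(_ (p M)); rewrite !inE eqxx orbT => /esym/predU1P[pv|/eqP //].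
  by move: vp; rewrite pv adj_irr.
rewrite (partition_big p (fun w => (w \in A) && adj v w)) /= => [|M]; last first.
  rewrite negbK => /andP[/andP[mM cM] vM].
  have /andP[-> pM] := pP M mM vM; rewrite andbT.
  by apply: (subsetP cM); apply/bigcupP; exists [set v; p M]; rewrite ?set22.
rewrite -sumrN; apply: eq_bigr => w /andP[wA vw].
have vNw := adj_neq vw; set e := [set v; w].
rewrite (reindex_onto (fun M => e |: M) (fun M => M :\ e)) /=; last first.
  move=> M /andP[/andP[/andP[mM _] vM] pM]; rewrite setD1K //.
  by rewrite -pE // -(negbK (v \in _)).
rewrite -sumrN; apply: eq_big => M; last first.
  case/andP=> /andP[/andP[/andP[mM cM] _] _] eM.
  have {}eM : e \notin M by rewrite -(eqP eM) !inE eqxx.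
  rewrite cardsU1 eM exprS mulN1r scaleNr cover_setU1.
  by rewrite /e !setDDl setUA.
have vC : v \in cover (e |: M) by rewrite cover_setU1 !inE eqxx.
have eA : e \subset A by rewrite subUset !sub1set vA.
have -> : (cover M \subset A :\ v :\ w)
    = (cover M \subset A) && [disjoint e & cover M].
  by rewrite !subsetD1 disjoints_subset subUset !sub1set !inE andbA.
have -> : ((e |: M) :\ e == M) = (e \notin M).
  apply/eqP/idP => [<-|eM]; first by rewrite !inE eqxx.
  by rewrite setU1K.
rewrite vC /= andbT cover_setU1 subUset eA /= [RHS]andbCA andbC.
rewrite -(matching_setU1 M vw) -/e.
case mM: (is_matching _) => //=; last by rewrite !andbF.
by rewrite pE // setU11 andbT andbC.
Qed.
End InducedMatchingPoly.

(** Matchings transfer edge by edge along [f]. This serves both the inclusion of a vertex-deleted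
    graph and the rotations of the cycle. *)
Lemma induced_poly_imset (R : realFieldType) (H G : graph) (f : H -> G)
    (A : {set H}) :
  injective f -> {mono f : x y / adj x y} ->
  induced_poly R (f @: A) = induced_poly R A.
Proof.
move=> f_inj f_adj; pose h (M : {set {set H}}) := [set f @: (e : {set H}) | e in M].
have im_inj : injective (fun e : {set H} => f @: e) by apply: imset_inj.
have h_inj : injective h by apply: imset_inj.
have edge_im (e : {set H}) : (f @: e \in edges G) = (e \in edges H).
  apply/edgesP/edgesP => [[x [y [xy E]]]|[x [y [xy ->]]]]; last first.
    by exists (f x), (f y); rewrite f_adj imsetU1 imset_set1.
  have /imsetP[a ae xE] : x \in f @: e by rewrite E set21.
  have /imsetP[b be yE] : y \in f @: e by rewrite E set22.
  exists a, b; rewrite -f_adj -xE -yE; split=> //; apply: im_inj.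
  by rewrite E imsetU1 imset_set1 xE yE.
have h_match (M : {set {set H}}) : is_matching (h M) = is_matching M.
  rewrite /is_matching imset_trivIset //; congr (_ && _).
  apply/subsetP/subsetP => sM e; last by case/imsetP=> d /sM dE ->; rewrite edge_im.
  by move=> eM; rewrite -edge_im sM // imset_f.
have h_cover (M : {set {set H}}) : cover (h M) = f @: cover M.
  apply/setP=> y; apply/bigcupP/imsetP => [[_ /imsetP[e eM ->]]|[x /bigcupP[e eM xe] ->]].
    by case/imsetP=> x xe ->; exists x => //; apply/bigcupP; exists e.
  by exists (f @: (e : {set H})); apply: imset_f.
rewrite /induced_poly.
rewrite (eq_bigl (mem (h @: [set M | is_matching M && (cover M \subset A)]))).
  rewrite big_imset /=; last by move=> ? ? _ _; apply: h_inj.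
  apply: eq_big => [M|M]; rewrite inE // => /andP[_ cM].
  by rewrite h_cover !cardsDS ?imsetS // !card_imset.
move=> M /=; apply/andP/imsetP => [[mM cM]|[M']]; last first.
  by rewrite inE => /andP[mM cM] ->; rewrite h_match h_cover imsetS.
(* Surjectivity of [h]: every edge of [M] lies in [f @: A], so it is the image of its preimage. *)
have hK : h [set e | f @: (e : {set H}) \in M] = M.
  apply/setP=> d; apply/imsetP/idP => [[e]|dM]; first by rewrite inE => ? ->.
  have dE : f @: (f @^-1: d) = d.
    apply/setP=> y; apply/imsetP/idP => [[x]|yd]; first by rewrite inE => ? ->.
    have /imsetP[x _ yE] : y \in f @: A.
      by apply: (subsetP cM); apply/bigcupP; exists d.
    by exists x; rewrite // inE -yE.
  by exists (f @^-1: d); rewrite ?inE dE.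
exists [set e | f @: (e : {set H}) \in M] => //.
rewrite inE -h_match hK mM /=; apply/subsetP=> x xM.
rewrite -(mem_imset _ _ f_inj); apply: (subsetP cM).
by rewrite -hK h_cover mem_imset.
Qed.

(** * Path polynomials, that is, the Chebyshev polynomials U_n(x/2), and their root at 1 *)

Fixpoint path_poly (R : realFieldType) (n : nat) : {poly R} :=
  match n with
  | 0 => 1
  | n'.+1 => if n' is m.+1 then 'X * path_poly R n' - path_poly R m else 'X
  end.

Lemma path_poly_rec (R : realFieldType) n :
  path_poly R n.+2 = 'X * path_poly R n.+1 - path_poly R n.
Proof. by []. Qed.

(** If the square of ['X - x] divided [q], the derivative would vanish at [x] too. *)
Lemma mup_simple (F : fieldType) (x : F) (q : {poly F}) :
  root q x -> ~~ root q^`() x -> mup x q = 1%N.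
Proof.
move=> qx dqx.
have q0 : q != 0 by apply: contraNneq dqx => ->; rewrite deriv0 root0.
apply/eqP; rewrite eqn_leq mup_leq // mup_geq // expr1 -root_factor_theorem qx.
rewrite andbT; apply: contra dqx => /dvdpP[r ->].
rewrite rootE expr2 !derivM !hornerE.
by rewrite /= subrr !(mulr0, mul0r, addr0).
Qed.

Section PathPolyAt1.
Variable R : realFieldType.
Local Notation P := (path_poly R).

(** Values and derivatives at two consecutive indices determine all later ones, so these four facts
    together are inductive; three steps of the recurrence negate the values. *)
Lemma path_poly_at1 k :
  [/\ (P (3 * k)).[1] = (-1) ^+ k, (P (3 * k).+1).[1] = (-1) ^+ k,
      (P (3 * k))^`().[1] = - (k%:R * (-1) ^+ k)
    & (P (3 * k).+1)^`().[1] = k.+1%:R * (-1) ^+ k].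
Proof.
elim: k => [|k [p0 p1 q0 q1]].
  rewrite muln0 /= derivX -(polyC1 R) derivC !hornerE; split=> //; ring.
have -> : (3 * k.+1 = (3 * k).+3)%N by lia.
rewrite !path_poly_rec.
rewrite !(derivB, derivM, derivX) !hornerE p0 p1 q0 q1 exprS -!(natr1 k.+1) -natr1.
by split=> /=; ring.
Qed.

Lemma path_poly_at1_2 k :
  (P (3 * k).+2).[1] = 0 /\
  (P (3 * k).+2)^`().[1] = (k.+1%:R * (-1) ^+ k) *+ 2.
Proof.
have [p0 p1 q0 q1] := path_poly_at1 k.
rewrite path_poly_rec !(derivB, derivM, derivX) !hornerE p0 p1 q0 q1 -natr1.
by split=> /=; ring.
Qed.

Lemma root_path_poly m : root (P m) 1 = (m %% 3 == 2)%N.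
Proof.
have [p0 p1 _ _] := path_poly_at1 (m %/ 3); have [p2 _] := path_poly_at1_2 (m %/ 3).
rewrite {1}(divn_eq m 3) mulnC rootE; have : (m %% 3 < 3)%N by rewrite ltn_mod.
case: (m %% 3)%N => [|[|[|//]]] _; rewrite ?addn0 ?addn1 ?addn2 ?p0 ?p1 ?p2 ?eqxx //.
all: by rewrite signr_eq0.
Qed.

Lemma root_deriv_path_poly m : (m %% 3 = 2)%N -> ~~ root (P m)^`() 1.
Proof.
move=> m3; rewrite (divn_eq m 3) m3 mulnC addn2 rootE.
by rewrite (path_poly_at1_2 _).2 mulrn_eq0 mulf_eq0 signr_eq0 pnatr_eq0.
Qed.

Lemma path_poly_neq0 m : P m != 0.
Proof.
have := root_path_poly m; case: eqP => [m3 _|_ /negbT].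
  by apply: contraNneq (root_deriv_path_poly m3) => ->; rewrite deriv0 root0.
by apply: contraNneq => ->; rewrite root0.
Qed.

Lemma mup_path_poly m : mup 1 (P m) = (m %% 3 == 2)%N.
Proof.
have := root_path_poly m; case: eqP => [m3|_ /negbT /mupNroot //] Pm1.
by rewrite mup_simple ?root_deriv_path_poly.
Qed.

End PathPolyAt1.

(** * Arcs of the cycle and the cycle polynomial *)

Definition arc n a b : {set 'I_n} := [set i : 'I_n | (a <= i < b)%N].

Lemma iter_ordS n k (i : 'I_n) : iter k (@ordS n) i = ((i + k) %% n)%N :> nat.
Proof.
elim: k => [|k IHk] /=; first by rewrite addn0 modn_small.
by rewrite IHk -addn1 modnDml addn1 addnS.
Qed.

Lemma cycle_adj_iter_ordS n k :
  {mono iter k (@ordS n) : i j / cycle_adj i j >-> cycle_adj i j}.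
Proof.
elim: k => [|k IHk] i j //; apply: etrans (IHk i j); rewrite /= /cycle_adj.
by rewrite !(inj_eq (@ordS_inj n)).
Qed.

(** With [i] nonzero, the wrap-around edge can only be traversed from [n.-1] to 0. *)
Lemma cycle_adjE n (i j : 'I_n) : (0 < i)%N ->
  cycle_adj i j = [|| (j == i.+1 :> nat), (i == j.+1 :> nat)
                    | [&& (j == 0 :> nat), (i == n.-1 :> nat) & (1 < n)%N]].
Proof.
move=> i0; have := ltn_ord i; have := ltn_ord j.
rewrite /cycle_adj -!val_eqE /= => jn i_n.
have mE (m : 'I_n) : (m.+1 %% n = if m.+1 == n then 0 else m.+1)%N.
  by case: eqP => [->|mn]; rewrite ?modnn ?modn_small //; have := ltn_ord m; lia.
by rewrite !mE; case: (i.+1 =P n); case: (j.+1 =P n); lia.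
Qed.

Section CyclePoly.
Variables (R : realFieldType) (n : nat).
Local Notation ipoly := (@induced_poly R (cycle_graph n)).
Local Notation P := (path_poly R).

(** The missing vertex [a + l] and the absence of 0 separate the arc from [B]; expanding at the
    first vertex of the arc reproduces the path recurrence. *)
Lemma induced_poly_arc a l (B : {set 'I_n}) :
  (0 < a)%N -> (a + l <= n)%N -> B \subset arc n (a + l).+1 n ->
  ipoly (arc n a (a + l) :|: B) = P l * ipoly B.
Proof.
elim/ltn_ind: l a => l IHl a a0 aln sB.
have Bge i : i \in B -> (a + l < i)%N.
  by move/(subsetP sB); rewrite inE => /andP[].
case: l IHl aln sB Bge => [_ _ _ _|l IHl aln sB Bge].
  rewrite mul1r (_ : arc n a _ = set0) ?set0U //.
  by apply/setP=> i; rewrite !inE; lia.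
have an : (a < n)%N by lia.
pose v : cycle_graph n := Ordinal an.
rewrite (@induced_poly_rec _ _ _ v); last by rewrite !inE /=; lia.
have -> : (arc n a (a + l.+1) :|: B) :\ v = arc n a.+1 (a.+1 + l) :|: B.
  apply/setP=> i; rewrite !inE -val_eqE /=.
  by case iB: (i \in B); [have := Bge _ iB|]; lia.
rewrite IHl //; [|lia|by rewrite addSnnS].
(* In a one-vertex arc [v] is isolated; in a longer one its only remaining neighbour is [a.+1]. *)
case: l IHl aln sB Bge => [|l] IHl aln sB Bge.
  rewrite big_pred0 ?subr0 ?mulr1 ?mul1r // => w.
  rewrite !inE [adj _ _]cycle_adjE //=; have := ltn_ord w.
  by case wB: (w \in B); [have := Bge _ wB|]; lia.
have an' : (a.+1 < n)%N by lia.
rewrite (big_pred1 (Ordinal an' : cycle_graph n)) => [|w]; last first.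
  rewrite !inE [adj _ _]cycle_adjE //= -val_eqE /=; have := ltn_ord w.
  by case wB: (w \in B); [have := Bge _ wB|]; lia.
have -> : (arc n a.+1 (a.+1 + l.+1) :|: B) :\ (Ordinal an')
    = arc n a.+2 (a.+2 + l) :|: B.
  apply/setP=> i; rewrite !inE -val_eqE /=.
  by case iB: (i \in B); [have := Bge _ iB|]; lia.
rewrite IHl //; [|lia|by rewrite !addSnnS].
by rewrite path_poly_rec mulrBl mulrA.
Qed.

Lemma induced_poly_arc1 a l :
  (0 < a)%N -> (a + l <= n)%N -> ipoly (arc n a (a + l)) = P l.
Proof.
by move=> a0 al; rewrite -[arc _ _ _]setU0 induced_poly_arc ?sub0set // induced_poly0 mulr1.
Qed.

(** Expansion at vertex 0: its neighbours 1 and [n.-1] are distinct, and deleting either one as well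
    leaves a path on [n.-2] vertices. *)
Lemma matching_poly_cycle : (2 < n)%N ->
  matching_poly (cycle_graph n) R = 'X * P n.-1 - P n.-2 *+ 2.
Proof.
move=> n2; have n0 : (0 < n)%N by lia.
have n1 : (1 < n)%N by lia.
have nn : (n.-1 < n)%N by lia.
pose v0 : cycle_graph n := Ordinal n0; pose v1 : cycle_graph n := Ordinal n1.
pose vn : cycle_graph n := Ordinal nn.
have D0 : [set: cycle_graph n] :\ v0 = arc n 1 (1 + n.-1).
  by apply/setP=> i; rewrite !inE -val_eqE /=; have := ltn_ord i; lia.
have D1 : arc n 1 (1 + n.-1) :\ v1 = arc n 2 (2 + n.-2).
  by apply/setP=> i; rewrite !inE -val_eqE /=; have := ltn_ord i; lia.
have Dn : arc n 1 (1 + n.-1) :\ vn = arc n 1 (1 + n.-2).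
  by apply/setP=> i; rewrite !inE -val_eqE /=; have := ltn_ord i; lia.
rewrite matching_polyE (@induced_poly_rec _ _ _ v0) ?inE // D0.
rewrite induced_poly_arc1 //.
rewrite (eq_bigl (mem [set v1; vn])) => [|w]; last first.
  (* Adjacency is flipped because [cycle_adjE] needs a nonzero first argument. *)
  rewrite !inE adj_sym -[adj _ _]/(cycle_adj w v0).
  have [/eqP w0|w0] := posnP w.
    have /eqP -> : w == v0 by rewrite -val_eqE.
    by rewrite /cycle_adj eqxx -!val_eqE /=; lia.
  by rewrite cycle_adjE // -!val_eqE /=; have := ltn_ord w; lia.
rewrite big_setU1 ?big_set1 /=; last by rewrite inE -val_eqE /=; lia.
by rewrite D1 Dn !induced_poly_arc1 //; lia.
Qed.

Lemma mult_cycle : (2 < n)%N -> mult (1 : R) (cycle_graph n) = 0%N.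
Proof.
move=> n2; apply: mupNroot; rewrite matching_poly_cycle // rootE !hornerE /=.
(* The value at 1 is that of P_(m+1) - 2 P_m: up to sign 1, 2, 1 for [m] = 0, 1, 2 modulo 3. *)
have [m ->] : exists m, n = m.+2 by exists n.-2; lia.
have [p0 p1 _ _] := path_poly_at1 R (m %/ 3).
have [p2 _] := path_poly_at1_2 R (m %/ 3).
have [p3 _ _ _] := path_poly_at1 R (m %/ 3).+1.
rewrite mulnSr addn3 in p3.
have := divn_eq m 3; have : (m %% 3 < 3)%N by rewrite ltn_mod.
case: (m %% 3)%N => [|[|[|//]]] _; rewrite mulnC ?addn0 ?addn1 ?addn2 => -> /=.
- by rewrite p1 p0 opprD addNKr oppr_eq0 signr_eq0.
- by rewrite p2 p1 sub0r oppr_eq0 -mulr2n mulrn_eq0 signr_eq0.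
- by rewrite p3 p2 addr0 subr0 signr_eq0.
Qed.
End CyclePoly.

(** * Deleting one or two vertices *)

Lemma matching_poly_del (R : realFieldType) (G : graph) (v : G) :
  matching_poly (del v) R = induced_poly R (~: [set v]).
Proof.
rewrite matching_polyE -(@induced_poly_imset _ _ G (fun x : del v => val x) _ val_inj) //; congr induced_poly.
apply/setP=> x; rewrite !inE; apply/imsetP/idP => [[y _ ->]|xv]; first exact: (valP y).
by exists (Sub x xv); rewrite ?inE.
Qed.

Lemma matching_poly_del2 (R : realFieldType) (G : graph) (v : G) (u : del v) :
  matching_poly (del u) R = induced_poly R (~: [set v; val u]).
Proof.
rewrite matching_poly_del -(@induced_poly_imset _ _ G (fun x : del v => val x) _ val_inj) //; congr induced_poly.
apply/setP=> x; rewrite !inE negb_or; apply/imsetP/andP => [[y]|[xv xu]].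
  by rewrite !inE => yu ->; split; first exact: (valP y).
by exists (Sub x xv); rewrite ?inE.
Qed.

Lemma imsetC_inj (T : finType) (f : T -> T) (A : {set T}) :
  injective f -> f @: (~: A) = ~: (f @: A).
Proof.
move=> f_inj; apply/setP=> y; rewrite -(f_invF f_inj y) inE !mem_imset //.
by rewrite inE.
Qed.

Section CycleDeletion.
Variables (R : realFieldType) (n : nat) (v : cycle_graph n).
Local Notation P := (path_poly R).
Implicit Type u : del v.

(* Rotating [v] to 0 turns the arc left by its deletion into the interval
   [1, n-1], on which adjacency does not wrap around. *)
Definition rot_to0 : 'I_n -> 'I_n := iter (n - v) (@ordS n).

Lemma rot_to0_inj : injective rot_to0.
Proof. by rewrite /rot_to0; elim: (n - v)%N => //= k IHk i j /ordS_inj /IHk. Qed.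

Lemma cycle_adj_rot_to0 : {mono rot_to0 : i j / cycle_adj i j}.
Proof. exact: cycle_adj_iter_ordS. Qed.

Lemma rot_to0_v : rot_to0 v = 0%N :> nat.
Proof. by rewrite iter_ordS subnKC ?modnn // ltnW. Qed.

Lemma rot_to0_gt0 u : (0 < rot_to0 (val u))%N.
Proof.
rewrite lt0n -rot_to0_v val_eqE (inj_eq rot_to0_inj); exact: (valP u).
Qed.

Lemma induced_poly_rot (A : {set cycle_graph n}) :
  induced_poly R A = @induced_poly R (cycle_graph n) (rot_to0 @: A).
Proof.
apply/esym/(@induced_poly_imset R (cycle_graph n)); first exact: rot_to0_inj.
exact: cycle_adj_rot_to0.
Qed.

Lemma mult_del : mult (1 : R) (del v) = (n %% 3 == 0)%N.
Proof.
have vn := ltn_ord v.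
rewrite /mult matching_poly_del induced_poly_rot imsetC_inj; last exact: rot_to0_inj.
rewrite imset_set1.
have -> : ~: [set rot_to0 v] = arc n 1 (1 + n.-1).
  by apply/setP=> i; rewrite !inE -val_eqE /= rot_to0_v; have := ltn_ord i; lia.
by rewrite induced_poly_arc1 ?mup_path_poly //; lia.
Qed.

(** With [v] at 0 and [u] at [r], paths on [r - 1] and [n - 1 - r] vertices remain; the polynomial
    is their product, so multiplicities add. *)
Lemma mult_del2 u :
  mult (1 : R) (del u)
  = (((rot_to0 (val u)) %% 3 == 0) + ((n - rot_to0 (val u)) %% 3 == 0))%N.
Proof.
have r0 := rot_to0_gt0 u; have rn := ltn_ord (rot_to0 (val u)).
rewrite /mult matching_poly_del2 induced_poly_rot imsetC_inj; last exact: rot_to0_inj.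
rewrite imsetU1 imset_set1; set r := rot_to0 (val u) in r0 rn *.
have -> : ~: [set rot_to0 v; r] = arc n 1 (1 + r.-1) :|: arc n r.+1 (r.+1 + (n.-1 - r)).
  by apply/setP=> i; rewrite !inE -!val_eqE /= rot_to0_v; have := ltn_ord i; lia.
rewrite induced_poly_arc //; last 2 first.
- by lia.
- by apply/subsetP=> i; rewrite !inE; have := ltn_ord i; lia.
rewrite induced_poly_arc1 //; last by lia.
by rewrite mupM ?path_poly_neq0 // !mup_path_poly; lia.
Qed.

End CycleDeletion.

Theorem theorem4p4 (R : realFieldType) (n : nat) (hn : (3 <= n)%N) :
  elementary (1 : R) (cycle_graph n) <->
  exists k : nat, (0 < k)%N /\ n = (3 * k)%N.
Proof.
split=> [/andP[/andP[_ /forallP pos] _]|[k [_ n3]]].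
  have n0 : (0 < n)%N by lia.
  (* Positivity of a single vertex already forces 3 to divide [n]. *)
  have := pos (Ordinal n0).
  rewrite /positive mult_cycle // (@mult_del R n (Ordinal n0)) => n3.
  by exists (n %/ 3)%N; lia.
have md (v : cycle_graph n) : mult (1 : R) (del v) = 1%N.
  by rewrite mult_del n3 mulnC modnMl.
apply/andP; split.
  apply/andP; split; first by rewrite mult_cycle.
  by apply/forallP => v; rewrite /positive mult_cycle // md.
apply/forallP => v; apply/eqP/setP => u; rewrite !inE.
pose r (x : del v) : nat := rot_to0 v (val x).
(* Since 3 divides [n], it divides [n - r x] exactly when it divides [r x]: both pieces contribute
   equally. *)
have mdd x : mult (1 : R) (del x) = ((r x %% 3 == 0) + (r x %% 3 == 0))%N.
  rewrite mult_del2 -/(r x); congr (_ + _)%N.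
  by have : (r x < n)%N := ltn_ord (rot_to0 v (val x)); lia.
rewrite /positive /special /essential md mdd.
(* If 3 does not divide [r u], then [u] is not positive; otherwise an essential neighbour has to be
   exhibited. *)
case r3: (r u %% 3 == 0)%N => //=; apply/existsP.
have r0 : (0 < r u)%N := rot_to0_gt0 u; have rn : (r u < n)%N := ltn_ord _.
have wn : ((r u).-1 < n)%N by lia.
(* The predecessor of [u] on the path; it differs from [v] because [r u] is a positive multiple of
   3, hence at least 3. *)
pose w := invF (@rot_to0_inj n v) (Ordinal wn).
have rw : rot_to0 v w = (r u).-1 :> nat by rewrite f_invF.
have wv : w != v.
  by apply/eqP => E; move: rw; rewrite E rot_to0_v; lia.
exists (Sub w wv : del v).
have mw : r (Sub w wv : del v) = (r u).-1 by rewrite /r SubK.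
apply/andP; split.
  change (is_true (cycle_adj (val u) w)).
  rewrite -(cycle_adj_rot_to0 v) cycle_adjE // rw -/(r u).
  by rewrite prednK // eqxx orbT.
by rewrite mdd mw; lia.
Qed.
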